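(* Let $d\ge 3$ and $r\ge 2$ be integers, and put $n=r^2+1$, $m=r^{d-1}$. Let $\mathbf{T}_0\in\mathbb{R}^{n\times\cdots\times n}$ ($d$ factors) be the tensor $$\mathbf{T}_0=\sum_{k_1,\dots,k_d=1}^r\Big(\bigotimes_{i=1}^d e_{\pi(k_{i+1},k_i)}\Big)+\bigotimes_{i=1}^d e_n \qquad (k_{d+1}:=k_1),$$ let $f_0(\vec{\mathbf{u}})=\frac12\|\mathbf{T}_0-\tau(\vec{\mathbf{u}})\|_F^2$ for $\vec{\mathbf{u}}\in\mathcal{U}^d_{m,n}$, and let $\vec{\mathbf{u}}_0=(\mathbf{u}^{[1]},\dots,\mathbf{u}^{[d]})\in\mathcal{U}^d_{m,n}$ be the point defined, for $1\le p_1,\dots,p_{d-1},q_1,\dots,q_{d-1}\le r$, by $$\mathbf{u}^{[i]}_{\pi(p_1,\dots,p_{d-1}),\pi(q_1,\dots,q_{d-1})}=\Big(\prod_{1\le l\le d-1,\ l\ne i}\delta_{p_l q_l}\Big)e_{\pi(p_i,q_i)},\qquad 1\le i\le d-1,$$ $$\mathbf{u}^{[d]}_{\pi(p_1,\dots,p_{d-1}),\pi(q_1,\dots,q_{d-1})}=\delta_{p_2q_1}\delta_{p_3q_2}\cdots\delta_{p_{d-1}q_{d-2}}\,e_{\pi(p_1,q_{d-1})}.$$ Then $\vec{\mathbf{u}}_0$ is a local minimum of the problem $\min_{\vec{\mathbf{u}}\in\mathcal{U}^d_{m,n}}f_0(\vec{\mathbf{u}})$ and $f_0(\vec{\mathbf{u}}_0)>0$.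 Hence $\vec{\mathbf{u}}_0$ is a spurious local minimum of this problem.
   Context: Notation. $\mathcal{U}^d_{m,n}=\big(\mathbb{R}^{m\times n\times m}\big)^d$. For $\vec{\mathbf{u}}=(\mathbf{u}^{[1]},\dots,\mathbf{u}^{[d]})\in\mathcal{U}^d_{m,n}$, $\mathbf{u}^{[i]}_{k,k'}=\mathbf{u}^{[i]}(k,:,k')\in\mathbb{R}^n$. The map $\tau$ sends $\vec{\mathbf{u}}$ to the $d$-th order tensor $$\tau(\vec{\mathbf{u}})=\sum_{k_1,\dots,k_d=1}^m\mathbf{u}^{[1]}_{k_1,k_2}\otimes\mathbf{u}^{[2]}_{k_2,k_3}\otimes\cdots\otimes\mathbf{u}^{[d]}_{k_d,k_1}\in\mathbb{R}^{n\times\cdots\times n}.$$ $\|\cdot\|_F$ is the Frobenius norm (square root of the sum of squares of all entries). $e_j\in\mathbb{R}^n$ is the $j$-th standard basis vector and $\delta$ is the Kronecker delta. The lexicographical order function on $s$-tuples with entries in $\{1,\dots,r\}$ is $\pi(k_1,\dots,k_s)=1+\sum_{i=1}^s(k_i-1)r^{s-i}\in\{1,\dots,r^s\}$; e.g. $\pi(k_1,k_2)=(k_1-1)r+k_2$. A point $\vec{\mathbf{u}}$ is a local minimum of a real-valued function $f$ if there exists $\eta>0$ such that $f(\vec{\mathbf{u}}+\vec{\mathbf{v}})\ge f(\vec{\mathbf{u}})$ for all $\vec{\mathbf{v}}$ with $\|\vec{\mathbf{v}}\|<\eta$ (any norm on the finite-dimensional space; e.g. the maximum of absolute values of all entries).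 It is a spurious local minimum if in addition $f(\vec{\mathbf{u}})>\min_{\vec{\mathbf{v}}}f(\vec{\mathbf{v}})$. *)

(* Defs.v *)
From mathcomp Require Import all_boot all_order all_algebra.
From mathcomp Require Import reals.

Set Implicit Arguments.
Unset Strict Implicit.
Unset Printing Implicit Defensive.

Import Order.TTheory GRing.Theory Num.Theory.

Local Open Scope ring_scope.

(* All indices start at 0, one less than in the usual mathematical notation. *)

Definition lex_val (r s : nat) (p : s.-tuple 'I_r) : nat :=
  (\sum_(l < s) tnth p l * r ^ (s - l.+1))%N.

Lemma lex_val_cons r s (x : 'I_r) (p : s.-tuple 'I_r) :
  lex_val [tuple of x :: p] = (x * r ^ s + lex_val p)%N.
Proof.
rewrite /lex_val big_ord_recl tnth0 subSS subn0; congr addn.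
by apply: eq_bigr => l _; rewrite tnthS subSS.
Qed.

Lemma lex_val_lt r s (p : s.-tuple 'I_r) : (lex_val p < r ^ s)%N.
Proof.
elim: s p => [|s IHs] p; first by rewrite /lex_val big_ord0.
case/tupleP: p => x p; rewrite lex_val_cons expnS.
apply: (@leq_trans (x.+1 * r ^ s)%N); last by rewrite leq_mul2r ltn_ord orbT.
by rewrite mulSn addnC ltn_add2r.
Qed.

Definition lex (r s : nat) (p : s.-tuple 'I_r) : 'I_(r ^ s) :=
  Ordinal (lex_val_lt p).

(* The inverse of lex reads off the base-r digits, most significant first. *)

Lemma digit_lt r s (k : 'I_(r ^ s)) (l : 'I_s) :
  (k %/ r ^ (s - l.+1) %% r < r)%N.
Proof.
apply: ltn_pmod; case: r k => [|//] [k /=].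
by rewrite exp0n //; apply: leq_ltn_trans (ltn_ord l).
Qed.

Definition unlex (r s : nat) (k : 'I_(r ^ s)) : s.-tuple 'I_r :=
  [tuple Ordinal (digit_lt k l) | l < s].

Lemma lexK r s : cancel (@lex r s) (@unlex r s).
Proof.
move=> p; apply: eq_from_tnth => l; rewrite tnth_mktuple; apply: val_inj => /=.
elim: s p l => [|s IHs] p l; first by case: l.
case/tupleP: p => x p; rewrite lex_val_cons.
have r_gt0 : (0 < r)%N by apply: leq_ltn_trans (ltn_ord x).
case: (unliftP ord0 l) => [j|] ->.
  rewrite tnthS -IHs subSS.
  have -> : (r ^ s = r ^ j * r * r ^ (s - j.+1))%N.
    by rewrite -expnSr -expnD subnKC.
  by rewrite mulnA divnMDl ?expn_gt0 ?r_gt0 // mulnA modnMDl.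
rewrite tnth0 subSS subn0 divnMDl ?expn_gt0 ?r_gt0 //.
by rewrite divn_small ?lex_val_lt // addn0 modn_small.
Qed.

Lemma unlexK r s : cancel (@unlex r s) (@lex r s).
Proof.
have /inj_card_bij [|g _ gK] := can_inj (@lexK r s).
  by rewrite card_tuple !card_ord.
by move=> k; rewrite -(gK k) lexK.
Qed.

Definition tensor (R : realType) (d n : nat) := {ffun {ffun 'I_d -> 'I_n} -> R}.

Definition tprod (R : realType) (d n : nat) (x : 'I_d -> 'rV[R]_n) :
    tensor R d n :=
  [ffun j : {ffun 'I_d -> 'I_n} => \prod_(i < d) x i 0 (j i)].

Definition frobenius (R : realType) (d n : nat) (T : tensor R d n) : R :=
  Num.sqrt (\sum_(j : {ffun 'I_d -> 'I_n}) T j ^+ 2).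

(* A core in R^(m x n x m) is the m x m matrix of its fibres u(k, :, k'). *)
Definition cores (R : realType) (d m n : nat) := {ffun 'I_d -> 'M['rV[R]_n]_m}.

Definition maxnorm (R : realType) (d m n : nat) (u : cores R d m n) : R :=
  \big[Num.max/0]_(i < d) \big[Num.max/0]_(k < m) \big[Num.max/0]_(k' < m)
    \big[Num.max/0]_(j < n) `|u i k k' 0 j|.

(* ordS is the cyclic successor on 'I_d. *)
Definition tau (R : realType) (d m n : nat) (u : cores R d m n) :
    tensor R d n :=
  \sum_(k : {ffun 'I_d -> 'I_m}) tprod (fun i => u i (k i) (k (ordS i))).

Definition local_min (R : realType) (d m n : nat) (f : cores R d m n -> R)
    (u : cores R d m n) : Prop :=
  exists2 eta : R, 0 < eta &
    forall v : cores R d m n, maxnorm v < eta -> f u <= f (u + v).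

Definition spurious_local_min (R : realType) (d m n : nat)
    (f : cores R d m n -> R) (u : cores R d m n) : Prop :=
  local_min f u /\
  exists w : cores R d m n, (forall v, f w <= f v) /\ f w < f u.

Definition e_pair (R : realType) (r : nat) (a b : 'I_r) : 'rV[R]_(r ^ 2 + 1) :=
  delta_mx 0 (lshift 1 (lex [tuple a; b])).

Definition e_last (R : realType) (r : nat) : 'rV[R]_(r ^ 2 + 1) :=
  delta_mx 0 (rshift (r ^ 2) ord0).

Definition T0 (R : realType) (d r : nat) : tensor R d (r ^ 2 + 1) :=
  \sum_(k : {ffun 'I_d -> 'I_r}) tprod (fun i => e_pair R (k (ordS i)) (k i))
  + tprod (fun=> e_last R r).

Definition f0 (R : realType) (d r m : nat) (u : cores R d m (r ^ 2 + 1)) : R :=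
  2^-1 * frobenius (T0 R d r - tau u) ^+ 2.

Definition kdelta (R : realType) (r : nat) (a b : 'I_r) : R := (a == b)%:R.

(* For d = s + 2 there are d - 1 = s + 1 digits; unlift ord_max i is None when
   i is the last position, and otherwise is i viewed in 'I_s.+1.  The value
   for d < 2 is a placeholder. *)
Definition u0 (R : realType) (d r : nat) : cores R d (r ^ d.-1) (r ^ 2 + 1) :=
  match d return cores R d (r ^ d.-1) (r ^ 2 + 1) with
  | s.+2 => [ffun i : 'I_s.+2 => \matrix_(k, k')
      let p := tnth (unlex k : s.+1.-tuple 'I_r) in
      let q := tnth (unlex k' : s.+1.-tuple 'I_r) in
      if unlift ord_max i is Some i' then
        (\prod_(l < s.+1 | l != i') kdelta R (p l) (q l))
          *: e_pair R (p i') (q i')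
      else
        (\prod_(l < s) kdelta R (p (lift ord0 l)) (q (lift ord_max l)))
          *: e_pair R (p ord0) (q ord_max)]
  | _ => 0
  end.

Lemma u0_init (R : realType) (s r : nat) (i : 'I_s.+1)
    (p q : s.+1.-tuple 'I_r) :
  u0 R s.+2 r (lift ord_max i) (lex p) (lex q) =
  (\prod_(l < s.+1 | l != i) kdelta R (tnth p l) (tnth q l))
    *: e_pair R (tnth p i) (tnth q i).
Proof. by rewrite ffunE mxE !lexK liftK. Qed.

Lemma u0_last (R : realType) (s r : nat) (p q : s.+1.-tuple 'I_r) :
  u0 R s.+2 r ord_max (lex p) (lex q) =
  (\prod_(l < s) kdelta R (tnth p (lift ord0 l)) (tnth q (lift ord_max l)))
    *: e_pair R (tnth p ord0) (tnth q ord_max).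
Proof. by rewrite ffunE mxE !lexK unlift_none. Qed.

(* Main.v *)
(* The fibres of u0 at the last slice n vanish, and T0 - tau u0 is the rank one
   tensor e_n (x) ... (x) e_n, so f0 u0 = 1/2. Write V_i for the n-th slice of
   the i-th core of a perturbation v.
   Cutting the cycle of u0 at a site i leaves an injective chain: for given
   bond values a, b at site i there are non-n indices on the other sites for
   which the product of the remaining entries of u0 vanishes on every bond
   configuration but one, and that one has the bonds a, b at i. Hence, for
   small v, some entry of tau (u0 + v) having n exactly at i is at least half
   of the largest entry of V_i, while T0 is zero there. The entry of
   tau (u0 + v) at (n, ..., n) is the trace of V_1 ... V_d; as d >= 3, it is at
   most a small multiple of max |V_d| * max |V_1|. The loss 2 tr (V_1 ... V_d)
   is thus absorbed by the squares of the entries found by cutting at d and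
   at 1.
   The global minimum is 0 because T0 has bond dimension r + 1 <= r ^ (d - 1). *)

Require Import Defs.
From mathcomp Require Import all_boot all_order all_algebra.
From mathcomp Require Import reals.
From mathcomp Require Import ring lra.

Set Implicit Arguments.
Unset Strict Implicit.
Unset Printing Implicit Defensive.

Import Order.TTheory GRing.Theory Num.Theory.

Local Open Scope ring_scope.

Arguments u0 : simpl never.

(** * Auxiliary identities and the two kinds of slice indices *)

Lemma prod_natr_bool (R : comNzRingType) (I : finType) (P b : pred I) :
  \prod_(i | P i) (b i)%:R = [forall (i | P i), b i]%:R :> R.
Proof.
case: forallP => [b_true|/forallP].
  by apply: big1 => i Pi; move: (b_true i); rewrite Pi /= => ->.
rewrite negb_forall => /existsP[i]; rewrite negb_imply => /andP[Pi /negPf bi].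
by rewrite (bigD1 i) //= bi mul0r.
Qed.

Lemma tauE (R : realType) (d m n : nat) (u : cores R d m n) j :
  tau u j = \sum_(k : {ffun 'I_d -> 'I_m}) \prod_i u i (k i) (k (ordS i)) 0 (j i).
Proof. by rewrite /tau sum_ffunE; apply: eq_bigr => k _; rewrite ffunE. Qed.

Lemma ordS_lift_max n (i : 'I_n) : ordS (lift ord_max i) = lift ord0 i.
Proof.
apply: val_inj; rewrite /= /bump leqNgt ltn_ord.
by rewrite modn_small ?add1n ?add0n ?ltnS.
Qed.

Lemma ordS_max n : ordS (@ord_max n) = ord0.
Proof. by apply: val_inj; rewrite /= modnn. Qed.

Lemma lift_max_eq0 n (i : 'I_n.+1) :
  (lift ord_max i == ord0) = (i == 0 :> nat).
Proof. by rewrite -val_eqE [X in X == _]lift_max. Qed.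

Lemma lift_max0 n (i : 'I_n) :
  lift ord_max (lift ord0 i) = lift ord0 (lift ord_max i).
Proof.
by apply: val_inj; rewrite [LHS]lift_max [RHS]lift0 [X in _ = X.+1]lift_max.
Qed.

Lemma lex_inj r s : injective (@lex r s).
Proof. exact: can_inj (@lexK r s). Qed.

Definition ix_pair (r : nat) (x y : 'I_r) : 'I_(r ^ 2 + 1) :=
  lshift 1 (lex [tuple x; y]).

Definition ix_last (r : nat) : 'I_(r ^ 2 + 1) := rshift (r ^ 2) ord0.

Lemma ix_pair_last (r : nat) (x y : 'I_r) : (ix_pair x y == ix_last r) = false.
Proof. by rewrite eq_lrshift. Qed.

Lemma ix_pair_eq (r : nat) (x y a b : 'I_r) :
  (ix_pair x y == ix_pair a b) = (x == a) && (y == b).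
Proof.
by rewrite eq_lshift (inj_eq (@lex_inj r 2)) -val_eqE /= !eqseq_cons andbT.
Qed.

Variant ix_spec (r : nat) : 'I_(r ^ 2 + 1) -> Type :=
  | IxPair x y : ix_spec (ix_pair x y)
  | IxLast : ix_spec (ix_last r).

Lemma ixP (r : nat) (j : 'I_(r ^ 2 + 1)) : ix_spec j.
Proof.
rewrite -(splitK j); case: (split j) => /= k; last by rewrite [k]ord1; constructor.
rewrite -(unlexK k); case/tupleP: (unlex k) => x p; case/tupleP: p => y p.
have -> : [tuple of x :: [tuple of y :: p]] = [tuple x; y].
  by apply: val_inj; rewrite /= [p]tuple0.
by constructor.
Qed.

(** * Entries of the target tensor and of [u0] *)

Section Entries.
Variables (R : realType) (r : nat).

Lemma e_pair_pair (a b x y : 'I_r) :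
  e_pair R a b 0 (ix_pair x y) = ((a == x) && (b == y))%:R.
Proof. by rewrite mxE eqxx /= ix_pair_eq [x == a]eq_sym [y == b]eq_sym. Qed.

Lemma e_pair_last (a b : 'I_r) : e_pair R a b 0 (ix_last r) = 0.
Proof. by rewrite mxE eqxx /= eq_sym ix_pair_last. Qed.

Lemma e_last_pair (x y : 'I_r) : e_last R r 0 (ix_pair x y) = 0.
Proof. by rewrite mxE eqxx /= ix_pair_last. Qed.

Lemma T0E (d : nat) j :
  T0 R d r j = \sum_(k : {ffun 'I_d -> 'I_r})
                  \prod_i e_pair R (k (ordS i)) (k i) 0 (j i)
               + \prod_i e_last R r 0 (j i).
Proof.
by rewrite !ffunE sum_ffunE; congr (_ + _); apply: eq_bigr => k _; rewrite ffunE.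
Qed.

End Entries.

(* The entries of u0 at pair indices are 0 or 1; this is where they are 1. *)
Definition hop (s r : nat) (i : 'I_s.+2) (k k' : 'I_(r ^ s.+1)) (x y : 'I_r) :
    bool :=
  let p := tnth (unlex k) in let q := tnth (unlex k') in
  if unlift ord_max i is Some i' then
    [&& [forall (l | l != i'), p l == q l], p i' == x & q i' == y]
  else [&& [forall l, p (lift ord0 l) == q (lift ord_max l)],
           p ord0 == x & q ord_max == y].

Lemma u0_pair (R : realType) (s r : nat) (i : 'I_s.+2) k k' (x y : 'I_r) :
  u0 R s.+2 r i k k' 0 (ix_pair x y) = (hop i k k' x y)%:R.
Proof.
rewrite ffunE mxE /hop; case: unliftP => [i' _|_];
  rewrite mxE e_pair_pair /kdelta prod_natr_bool -natrM mulnb //.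
Qed.

Lemma u0_ix_last (R : realType) (s r : nat) (i : 'I_s.+2) k k' :
  u0 R s.+2 r i k k' 0 (ix_last r) = 0.
Proof.
by rewrite ffunE mxE; case: unliftP => [i' _|_]; rewrite mxE e_pair_last mulr0.
Qed.

(** * Bond configurations along the opened cycle *)

Section Paths.
Variables (s r : nat).
Implicit Types (K : {ffun 'I_s.+2 -> 'I_(r ^ s.+1)}) (x y : 'I_s.+2 -> 'I_r).

Definition hop_along K x y (i : 'I_s.+2) := hop i (K i) (K (ordS i)) (x i) (y i).

(** The site is a natural number, so that neighbours are [l] and [l.+1] and induction along the
    opened cycle is possible. Only [l <= s.+1] is meaningful: beyond that [inord] falls back to
    [ord0]. *)
Definition digit K (l : nat) (c : 'I_s.+1) := tnth (unlex (K (inord l))) c.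

Lemma eq_digits K K' :
  (forall (l : 'I_s.+2) c, digit K l c = digit K' l c) -> K = K'.
Proof.
move=> eqK; apply/ffunP => l; apply: can_inj (@unlexK r s.+1) _ _ _.
by apply: eq_from_tnth => c; move: (eqK l c); rewrite /digit inord_val.
Qed.

Lemma hop_along_lift K x y (i : 'I_s.+1) :
  reflect [/\ forall c, c != i -> digit K i c = digit K i.+1 c,
              digit K i i = x (lift ord_max i) &
              digit K i.+1 i = y (lift ord_max i)]
          (hop_along K x y (lift ord_max i)).
Proof.
rewrite /hop_along /hop liftK ordS_lift_max /digit.
have -> : inord i = lift ord_max i.
  by apply: val_inj; rewrite [RHS]lift_max /= inordK // ltnW // ltnS.
have -> : inord i.+1 = lift ord0 i.
  by apply: val_inj; rewrite [RHS]lift0 /= inordK // ltnS.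
apply: (iffP and3P) => [[/forall_inP eqc /eqP -> /eqP ->]|[eqc -> ->]]; split=> //.
  by move=> c /eqc/eqP.
by apply/forall_inP => c /eqc ->.
Qed.

Lemma hop_along_max K x y :
  reflect [/\ forall c : 'I_s,
                digit K s.+1 (lift ord0 c) = digit K 0 (lift ord_max c),
              digit K s.+1 ord0 = x ord_max & digit K 0 ord_max = y ord_max]
          (hop_along K x y ord_max).
Proof.
rewrite /hop_along /hop unlift_none ordS_max /digit.
have -> : inord s.+1 = ord_max :> 'I_s.+2 by apply: val_inj; rewrite /= inordK.
have -> : inord 0 = ord0 :> 'I_s.+2 by apply: val_inj; rewrite /= inordK.
apply: (iffP and3P) => [[/forallP eqc /eqP -> /eqP ->]|[eqc -> ->]]; split=> //.
  by move=> c; apply/eqP.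
by apply/forallP => c; apply/eqP.
Qed.

(* Only site c acts on digit c, turning it from x c into y c. *)
Definition turn x y (l : nat) (c : 'I_s.+1) :=
  if (l <= c)%N then x (lift ord_max c) else y (lift ord_max c).

Lemma turn_last x y c : turn x y s.+1 c = y (lift ord_max c).
Proof. by rewrite /turn leqNgt ltn_ord. Qed.

(** Digit [c] can change only at site [c]. If that site lies on the chain, the digit is pinned to
    [x] before it and to [y] after it; otherwise it keeps its final value. The cuts at the last and
    at the first site take [lo] to be 0 and 1. *)
Lemma digit_chain K x y (lo : nat) :
    (forall i : 'I_s.+1, (lo <= i)%N -> hop_along K x y (lift ord_max i)) ->
  forall (c : 'I_s.+1) l, (lo <= l <= s.+1)%N ->
    digit K l c = if (lo <= c)%N then turn x y l c else digit K s.+1 c.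
Proof.
move=> hopK c.
have step l : (lo <= l <= s)%N -> l != c :> nat ->
    digit K l c = digit K l.+1 c.
  case/andP=> le_lo le_s neq_lc.
  have := hopK (inord l); rewrite inordK ?ltnS // => /(_ le_lo)/hop_along_lift.
  rewrite inordK ?ltnS // => -[eq_c _ _]; apply: eq_c.
  by rewrite -val_eqE /= inordK ?ltnS // eq_sym.
(* Digit [c] is constant on every stretch of sites that avoids site [c]. *)
have up a b : (lo <= a <= b)%N -> (b <= s.+1)%N ->
    (forall l, (a <= l < b)%N -> l != c) -> digit K a c = digit K b c.
  case/andP=> le_lo; elim: b => [|b IHb]; first by rewrite leqn0 => /eqP ->.
  rewrite leq_eqVlt => /predU1P[-> //|]; rewrite ltnS => le_ab le_bs nec.
  rewrite IHb ?(ltnW le_bs) //; last first.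
    by move=> l /andP[al lb]; rewrite nec // al ltnS ltnW.
  by rewrite step ?nec ?le_ab ?ltnS ?leqnn // (leq_trans le_lo).
move=> l /andP[le_lo le_s]; rewrite /turn.
have lt_c := ltn_ord c.
case: ifP => le_c; last first.
  rewrite (@up l s.+1) ?le_lo // => i /andP[li _].
  by rewrite gtn_eqF // (leq_trans _ li) // (leq_trans _ le_lo) // ltnNge le_c.
have /hop_along_lift[_ Kx Ky] := hopK _ le_c.
case: leqP => lc.
  rewrite -Kx (@up l c) ?le_lo ?(ltnW lt_c) // => i /andP[_ ic].
  by rewrite ltn_eqF.
rewrite -Ky (@up c.+1 l) ?lc ?(leq_trans le_c) // => i /andP[ci _].
by rewrite gtn_eqF.
Qed.

(* The only bond configurations compatible with u0 on all sites but the last,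
   resp. but the first, when site l carries the index pair (x l, y l). *)
Definition path_max x y : {ffun 'I_s.+2 -> 'I_(r ^ s.+1)} :=
  [ffun l : 'I_s.+2 => lex [tuple turn x y l c | c < s.+1]].

Definition path_0 x y : {ffun 'I_s.+2 -> 'I_(r ^ s.+1)} :=
  [ffun l : 'I_s.+2 => lex [tuple
     if l == ord0 then y (lift ord0 c)
     else if c == ord0 then x ord_max else turn x y l c | c < s.+1]].

Lemma digit_path_max x y l c : (l <= s.+1)%N -> digit (path_max x y) l c = turn x y l c.
Proof. by move=> les; rewrite /digit ffunE lexK tnth_mktuple inordK. Qed.

Lemma digit_path_0 x y l c : (l <= s.+1)%N ->
  digit (path_0 x y) l c = if l == 0 then y (lift ord0 c)
     else if c == ord0 then x ord_max else turn x y l c.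
Proof. by move=> les; rewrite /digit ffunE lexK tnth_mktuple -val_eqE /= inordK. Qed.

Lemma path_maxP K x y :
  [forall (l | l != ord_max), hop_along K x y l] = (K == path_max x y).
Proof.
apply/forall_inP/eqP => [hopK|-> l].
  apply: eq_digits => l c; rewrite digit_path_max ?leq_ord //.
  rewrite (@digit_chain K x y 0) ?leq_ord // => i _.
  by apply: hopK; rewrite eq_sym neq_lift.
case: (unliftP ord_max l) => [i ->|->]; last by rewrite eqxx.
move=> _; apply/hop_along_lift.
have lt_i := ltn_ord i.
split=> [c nec||]; rewrite !digit_path_max ?(ltnW lt_i) // /turn ?leqnn ?ltnn //.
by rewrite [(i <= c)%N]leq_eqVlt eq_sym val_eqE (negPf nec).
Qed.

(** Sites 1 to [s] never touch digit 0, so it is carried unchanged to the last core, which reads it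
    as [x ord_max]. That core also shifts the other digits by one place, so digit [c] of the bond at
    site 0 is the [y] of site [c + 1]. *)
Lemma path_0P K x y :
  [forall (l | l != ord0), hop_along K x y l] = (K == path_0 x y).
Proof.
apply/forall_inP/eqP => [hopK|-> l].
  have /hop_along_max[Kshift Kx Ky] := hopK ord_max isT.
  have chain : forall i : 'I_s.+1, (0 < i)%N -> hop_along K x y (lift ord_max i).
    by move=> i i_gt0; apply: hopK; rewrite lift_max_eq0 -lt0n.
  apply: eq_digits => l c; rewrite digit_path_0 ?leq_ord //; case: eqP => [->|/eqP nz].
    case: (unliftP ord_max c) => [c' ->|->]; last first.
      by rewrite Ky; congr y; apply: val_inj.
    rewrite -Kshift (digit_chain chain) ?leqnn //= turn_last.
    by rewrite lift_max0.
  rewrite (digit_chain chain) ?lt0n ?nz ?leq_ord // -val_eqE /=.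
  by case: eqP => [c0|//]; rewrite -Kx; congr digit; apply: val_inj.
case: (unliftP ord_max l) => [i ->|->] => nz; [apply/hop_along_lift|apply/hop_along_max].
  have lt_i := ltn_ord i.
  have i_neq0 : val i != 0 by rewrite lift_max_eq0 in nz.
  split=> [c nec||]; rewrite !digit_path_0 ?(ltnW lt_i) //=
     ?(negPf i_neq0) // -?val_eqE /= ?(negPf i_neq0) /turn ?leqnn ?ltnn //.
  have -> : (i <= c)%N = (i < c)%N.
    by rewrite leq_eqVlt [i == c :> nat]eq_sym (negPf nec : (_ == i :> nat) = _).
  by [].
split=> [c||].
- rewrite !digit_path_0 // lift_eqF eqxx /= turn_last.
  by rewrite lift_max0.
- by rewrite digit_path_0.
- by rewrite digit_path_0 //=; congr y; apply: val_inj.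
Qed.

End Paths.

(* The entries of u0 on the sites other than i separate all pairs of bonds at
   site i. *)
Definition injective_cut (R : realType) (s r : nat) (i : 'I_s.+2) : Prop :=
  forall a b : 'I_(r ^ s.+1), exists x y (K : {ffun 'I_s.+2 -> 'I_(r ^ s.+1)}),
    [/\ K i = a, K (ordS i) = b &
    forall K' : {ffun 'I_s.+2 -> 'I_(r ^ s.+1)},
      \prod_(l | l != i)
         u0 R s.+2 r l (K' l) (K' (ordS l)) 0 (ix_pair (x l) (y l))
      = (K' == K)%:R].

Lemma u0_prod_max (R : realType) (s r : nat) (x y : 'I_s.+2 -> 'I_r)
    (K : {ffun 'I_s.+2 -> 'I_(r ^ s.+1)}) :
  \prod_(l | l != ord_max) u0 R s.+2 r l (K l) (K (ordS l)) 0 (ix_pair (x l) (y l))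
  = (K == path_max x y)%:R.
Proof.
rewrite -path_maxP -prod_natr_bool.
by apply: eq_bigr => l _; rewrite u0_pair.
Qed.

Lemma u0_prod_0 (R : realType) (s r : nat) (x y : 'I_s.+2 -> 'I_r)
    (K : {ffun 'I_s.+2 -> 'I_(r ^ s.+1)}) :
  \prod_(l | l != ord0) u0 R s.+2 r l (K l) (K (ordS l)) 0 (ix_pair (x l) (y l))
  = (K == path_0 x y)%:R.
Proof.
rewrite -path_0P -prod_natr_bool.
by apply: eq_bigr => l _; rewrite u0_pair.
Qed.

Lemma injective_cut_max (R : realType) (s r : nat) : injective_cut R r (@ord_max s.+1).
Proof.
move=> a b.
(* The chain starts with bond [b] and ends with bond [a], so site [c] must turn digit [c] of [b]
   into digit [c] of [a]. The default is taken only at the cut site. *)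
pose g (t : 'I_(r ^ s.+1)) i := tnth (unlex t) (odflt ord0 (unlift ord_max i)).
exists (g b), (g a), (path_max (g b) (g a)); split; last exact: u0_prod_max.
  rewrite ffunE -[RHS]unlexK; congr lex; apply: eq_from_tnth => c.
  by rewrite tnth_mktuple turn_last /g liftK.
rewrite ordS_max ffunE -[RHS]unlexK; congr lex; apply: eq_from_tnth => c.
by rewrite tnth_mktuple /turn /g liftK.
Qed.

Lemma injective_cut_0 (R : realType) (s r : nat) : injective_cut R r (@ord0 s.+1).
Proof.
move=> a b.
(* Here the default matters: [x ord_max] has to be digit 0 of [b]. In [y], whose digits are
   displaced by one place, the default is taken only at the cut site. *)
pose x i := tnth (unlex b) (odflt ord0 (unlift ord_max i)).
pose y i := tnth (unlex a) (odflt ord0 (unlift ord0 i)).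
exists x, y, (path_0 x y); split; last exact: u0_prod_0.
  rewrite ffunE -[RHS]unlexK; congr lex; apply: eq_from_tnth => c.
  by rewrite tnth_mktuple eqxx /y liftK.
rewrite ffunE -[RHS]unlexK; congr lex; apply: eq_from_tnth => c.
rewrite tnth_mktuple -val_eqE /= modn_small // /turn /x.
case: eqP => [->|/eqP c_neq0]; first by rewrite unlift_none.
by rewrite lt0n -val_eqE /= in c_neq0 *; rewrite c_neq0 liftK.
Qed.

(** * The residual at [u0] *)

(** The second slots force [k = y], so at most one term of the sum survives; the first slots then
    require the pairs to close up cyclically. *)
Lemma T0_pairs (R : realType) (d r : nat) (x y : 'I_d.+1 -> 'I_r) :
  T0 R d.+1 r [ffun i => ix_pair (x i) (y i)]
  = [forall i, y (ordS i) == x i]%:R.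
Proof.
rewrite T0E [X in _ + X](bigD1 ord0) //= ffunE e_last_pair mul0r addr0.
have prodE (k : {ffun 'I_d.+1 -> 'I_r}) :
    \prod_i e_pair R (k (ordS i)) (k i) 0 ([ffun i => ix_pair (x i) (y i)] i) =
    [forall i, (k (ordS i) == x i) && (k i == y i)]%:R.
  by rewrite -(prod_natr_bool _ xpredT); apply: eq_bigr => i _; rewrite ffunE e_pair_pair.
rewrite (eq_bigr _ (fun k _ => prodE k)) (bigD1 [ffun i => y i]) //= big1 ?addr0.
  by congr (_%:R); congr nat_of_bool; apply: eq_forallb => i; rewrite !ffunE eqxx andbT.
move=> k; apply: contraNeq; rewrite pnatr_eq0 eqb0 negbK => /forallP k_xy.
by apply/eqP/ffunP => i; rewrite ffunE; case/andP: (k_xy i) => _ /eqP.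
Qed.

(** All sites but the last admit the single configuration [path_max x y], so the sum reduces to one
    factor, which tests whether the last core closes the cycle. *)
Lemma tau_u0_pairs (R : realType) (s r : nat) (x y : 'I_s.+2 -> 'I_r) :
  tau (u0 R s.+2 r) [ffun i => ix_pair (x i) (y i)]
  = [forall i, y (ordS i) == x i]%:R.
Proof.
have jE l : [ffun i => ix_pair (x i) (y i)] l = ix_pair (x l) (y l) by rewrite ffunE.
rewrite tauE (bigD1 (path_max x y)) //= [X in _ + X]big1 ?addr0; last first.
  move=> K neqK; rewrite (bigD1 ord_max) //= [X in _ * X](_ : _ = 0) ?mulr0 //.
  rewrite -[RHS]/(false%:R) -(negPf neqK) -u0_prod_max.
  by apply: eq_bigr => l _; rewrite jE.
rewrite (bigD1 ord_max) //= [X in _ * X](_ : _ = 1); last first.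
  rewrite -[RHS]/(true%:R) -(eqxx (path_max x y)) -u0_prod_max.
  by apply: eq_bigr => l _; rewrite jE.
rewrite mulr1 jE u0_pair; congr (_%:R); congr nat_of_bool.
(* The shift of digits in the last core compares the [y] of each inner site with the [x] of its
   predecessor; the two remaining conditions give the links into site 0 and into the last site. *)
apply/(hop_along_max (path_max x y) x y)/forallP.
  case=> shift x0 yl i; move: x0 yl.
  rewrite !digit_path_max // turn_last /turn /= => x0 yl.
  case: (unliftP ord_max i) => [c ->|->]; last first.
    by rewrite ordS_max -x0; apply/eqP; congr y; apply: val_inj.
  rewrite ordS_lift_max; case: (unliftP ord_max c) => [c' ->|->].
    by have := shift c'; rewrite !digit_path_max // turn_last lift_max0 /turn /= => ->.
  by rewrite yl; apply/eqP; congr y; apply: val_inj.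
move=> yx; split=> [c||]; rewrite !digit_path_max // ?turn_last /turn /=.
- by rewrite lift_max0 -ordS_lift_max; apply/eqP.
- rewrite -(eqP (yx ord_max)) ordS_max; congr y; exact: val_inj.
- rewrite -(eqP (yx _)) ordS_lift_max; congr y; exact: val_inj.
Qed.

Lemma tau_u0_last (R : realType) (s r : nat)
    (j : {ffun 'I_s.+2 -> 'I_(r ^ 2 + 1)}) (i : 'I_s.+2) :
  j i = ix_last r -> tau (u0 R s.+2 r) j = 0.
Proof.
move=> ji; rewrite tauE; apply: big1 => K _.
by rewrite (bigD1 i) //= ji u0_ix_last mul0r.
Qed.

Lemma T0_last (R : realType) (d r : nat)
    (j : {ffun 'I_d -> 'I_(r ^ 2 + 1)}) (i : 'I_d) :
  j i = ix_last r -> T0 R d r j = \prod_l e_last R r 0 (j l).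
Proof.
move=> ji; rewrite T0E big1 ?add0r // => K _.
by rewrite (bigD1 i) //= ji e_pair_last mul0r.
Qed.

(** At pair indices both tensors are the same indicator. As soon as one index is [ix_last r],
    [tau u0] vanishes and only the last term of [T0] is left. *)
Lemma T0_sub_tau_u0 (R : realType) (s r : nat) :
  T0 R s.+2 r - tau (u0 R s.+2 r) = tprod (fun=> e_last R r).
Proof.
apply/ffunP => j; rewrite [LHS]ffunE [X in _ + X]ffunE [RHS]ffunE.
case: (pickP (fun i => j i == ix_last r)) => [i /eqP ji|j_neq].
  by rewrite (tau_u0_last R ji) (T0_last R ji) subr0.
have /fin_all_exists[xy jE] i : exists p : 'I_r * 'I_r, j i = ix_pair p.1 p.2.
  by move: (j_neq i); case: (ixP (j i)) => [x y _|]; [exists (x, y)|rewrite eqxx].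
have -> : j = [ffun i => ix_pair (xy i).1 (xy i).2] by apply/ffunP => i; rewrite ffunE.
rewrite T0_pairs tau_u0_pairs subrr (bigD1 ord0) //= ffunE.
by rewrite e_last_pair mul0r.
Qed.

(** * Estimates for small perturbations *)

(** The base 3 comes from the recursion: a new factor, of size at most 2, doubles the old error, and
    its own perturbation adds at most [eta]. *)
Lemma prod_perturbation_seq (R : realFieldType) (I : Type) (s : seq I) (P : pred I)
    (x y : I -> R) (eta : R) :
    0 <= eta <= 1 -> (forall i, P i -> `|x i| <= 1) ->
    (forall i, P i -> `|y i| <= eta) ->
  `|\prod_(i <- s | P i) (x i + y i) - \prod_(i <- s | P i) x i|
    <= 3 ^+ size s * eta.
Proof.
move=> /andP[eta_ge0 eta_le1] x_le1 y_le.
have x_prod t : `|\prod_(i <- t | P i) x i| <= 1.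
  by rewrite normr_prod prodr_ile1 // => i Pi; rewrite normr_ge0 x_le1.
elim: s => [|i s IHs]; first by rewrite !big_nil subrr normr0 mul1r.
rewrite !big_cons /= exprS; case: ifP => Pi; last first.
  by apply: le_trans IHs _; rewrite ler_wpM2r // ler_peMl ?exprn_ge0 ?ler1n.
move: (x_prod s) IHs; set p := \prod_(_ <- s | _) _; set q := \prod_(_ <- s | _) _.
move=> q_le1 IHs.
have three_ge1 : 1 <= 3 ^+ size s :> R by rewrite exprn_ege1 // ler1n.
have -> : (x i + y i) * q - x i * p = (x i + y i) * (q - p) + y i * p by ring.
apply: le_trans (ler_normD _ _) _; rewrite !normrM.
have xy_le2 : `|x i + y i| <= 2.
  by apply: le_trans (ler_normD _ _) _; rewrite lerD ?x_le1 // (le_trans (y_le i Pi)).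
have -> : 3 * 3 ^+ size s * eta = 2 * (3 ^+ size s * eta) + 3 ^+ size s * eta by ring.
apply: lerD; first by apply: ler_pM.
apply: (@le_trans _ _ (eta * 1)); first by apply: ler_pM => //; exact: y_le.
by rewrite mulr1 ler_peMl.
Qed.

Lemma prod_perturbation (R : realFieldType) (I : finType) (P : pred I)
    (x y : I -> R) (eta : R) :
    0 <= eta <= 1 -> (forall i, P i -> `|x i| <= 1) ->
    (forall i, P i -> `|y i| <= eta) ->
  `|\prod_(i | P i) (x i + y i) - \prod_(i | P i) x i| <= 3 ^+ #|I| * eta.
Proof.
move=> eta01 x_le1 y_le; rewrite cardT enumT.
by have := prod_perturbation_seq (index_enum I) eta01 x_le1 y_le; rewrite unlock.
Qed.

Lemma cores_addE (R : realType) (d m n : nat) (u v : cores R d m n) i k k' j :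
  (u + v) i k k' 0 j = u i k k' 0 j + v i k k' 0 j.
Proof. by rewrite ffunE !mxE. Qed.

Lemma le_maxnorm (R : realType) (d m n : nat) (u : cores R d m n) i k k' j :
  `|u i k k' 0 j| <= maxnorm u.
Proof.
apply: le_trans (le_bigmax _ _ i); apply: le_trans (le_bigmax _ _ k).
by apply: le_trans (le_bigmax _ _ k'); apply: le_trans (le_bigmax _ _ j).
Qed.

Lemma norm_u0_le1 (R : realType) (s r : nat) i k k' j :
  `|u0 R s.+2 r i k k' 0 j| <= 1.
Proof.
case: (ixP j) => [x y|]; last by rewrite u0_ix_last normr0.
by rewrite u0_pair; case: hop; rewrite ?normr1 ?normr0.
Qed.

Lemma ex_max_entry (R : realType) (m : nat) (F : 'I_m -> 'I_m -> R) :
  (0 < m)%N -> exists a b, forall a' b', F a' b' <= F a b.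
Proof.
case: m F => // m F _.
have [[a b] _ max_ab] :=
  @arg_maxP _ _ _ (ord0, ord0) xpredT (fun p : 'I_m.+1 * 'I_m.+1 => F p.1 p.2) isT.
by exists a, b => a' b'; apply: (max_ab (a', b')).
Qed.

Section LowerBound.
Variables (R : realType) (s r : nat) (v : cores R s.+2 (r ^ s.+1) (r ^ 2 + 1)).
Variable eta : R.
Hypotheses (eta01 : 0 <= eta <= 1) (v_le : forall i k k' j, `|v i k k' 0 j| <= eta).

Let paths := {ffun 'I_s.+2 -> 'I_(r ^ s.+1)}.

(** Since [u0] vanishes on the last slice, every path contributes a factor from [v i], bounded by
    the maximal entry. The error is therefore relative to that entry, not merely of order [eta], and
    smallness keeps it below one half. *)
Lemma cut_entry_ge (i : 'I_s.+2) (a b : 'I_(r ^ s.+1)) :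
    injective_cut R r i -> #|paths|%:R * (3 ^+ s.+2 * eta) <= 2^-1 ->
    (forall a' b', `|v i a' b' 0 (ix_last r)| <= `|v i a b 0 (ix_last r)|) ->
  exists j : {ffun 'I_s.+2 -> 'I_(r ^ 2 + 1)},
    [/\ j i = ix_last r, forall l, l != i -> j l != ix_last r &
    `|v i a b 0 (ix_last r)| / 2 <= `|tau (u0 R s.+2 r + v) j|].
Proof.
move=> cut_i small max_ab; have [x [y [K [Ka Kb prodK]]]] := cut_i a b.
set N := `|_| in max_ab *.
exists [ffun l => if l == i then ix_last r else ix_pair (x l) (y l)]; split.
- by rewrite ffunE eqxx.
- by move=> l /negPf li; rewrite ffunE li ix_pair_last.
set j := finfun _.
have ji : j i = ix_last r by rewrite ffunE eqxx.
have jl l : l != i -> j l = ix_pair (x l) (y l) by move=> /negPf li; rewrite ffunE li.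
(* The entry is rewritten as a sum over all paths, of which only [K] contributes, in order to
   compare it with [tau] term by term. *)
have vE : v i a b 0 (ix_last r) =
    \sum_(K' : paths) v i (K' i) (K' (ordS i)) 0 (ix_last r) *
      \prod_(l | l != i) u0 R s.+2 r l (K' l) (K' (ordS l)) 0 (j l).
  rewrite (bigD1 K) //= [X in _ + X]big1 => [|K' /negPf neqK].
    rewrite (eq_bigr _ (fun l li => congr1 _ (jl l li))) prodK eqxx.
    by rewrite Ka Kb mulr1 addr0.
  by rewrite (eq_bigr _ (fun l li => congr1 _ (jl l li))) prodK neqK mulr0.
have tauE' : tau (u0 R s.+2 r + v) j =
    \sum_(K' : paths) v i (K' i) (K' (ordS i)) 0 (ix_last r) *
      \prod_(l | l != i) (u0 R s.+2 r l (K' l) (K' (ordS l)) 0 (j l)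
                          + v l (K' l) (K' (ordS l)) 0 (j l)).
  rewrite tauE; apply: eq_bigr => K' _; rewrite (bigD1 i) //= ji.
  rewrite cores_addE u0_ix_last add0r; congr (_ * _).
  by apply: eq_bigr => l _; rewrite cores_addE.
have : `|tau (u0 R s.+2 r + v) j - v i a b 0 (ix_last r)| <= N / 2.
  rewrite tauE' {1}vE -sumrB; apply: le_trans (ler_norm_sum _ _ _) _.
  apply: (@le_trans _ _ (\sum_(K' : paths) N * (3 ^+ s.+2 * eta))).
    apply: ler_sum => K' _; rewrite -mulrBr normrM.
    apply: ler_pM; rewrite ?max_ab //.
    rewrite -[X in 3 ^+ X](card_ord s.+2).
    by apply: prod_perturbation => // l _; exact: norm_u0_le1.
  rewrite sumr_const -[X in X <= _]mulr_natl mulrCA.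
  by apply: ler_wpM2l small; exact: normr_ge0.
have := lerB_dist (v i a b 0 (ix_last r))
                  (v i a b 0 (ix_last r) - tau (u0 R s.+2 r + v) j).
by rewrite subKr distrC -/N; lra.
Qed.

(** Each term is a product of entries of [v] alone. Two sites give [N] and [N'], a third one gives
    [eta], and all further factors are at most 1. *)
Lemma corner_entry_le (i i' i'' : 'I_s.+2) (N N' : R) :
    i' != i -> i'' != i -> i'' != i' ->
    (forall a b, `|v i a b 0 (ix_last r)| <= N) ->
    (forall a b, `|v i' a b 0 (ix_last r)| <= N') ->
  `|tau (u0 R s.+2 r + v) [ffun=> ix_last r]| <= #|paths|%:R * (N * (N' * eta)).
Proof.
move=> i'i i''i i''i' vN vN'; 
have jE (l : 'I_s.+2) : [ffun=> ix_last r] l = ix_last r by rewrite ffunE.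
rewrite tauE mulr_natl -sumr_const.
apply: le_trans (ler_norm_sum _ _ _) _; apply: ler_sum => K _.
rewrite (eq_bigr (fun l => v l (K l) (K (ordS l)) 0 (ix_last r))); last first.
  by move=> l _; rewrite cores_addE jE u0_ix_last add0r.
rewrite normr_prod (bigD1 i) //= (bigD1 i') //= (bigD1 i'') /=; last by rewrite i''i.
have /andP[eta_ge0 eta_le1] := eta01.
apply: ler_pM; rewrite ?normr_ge0 ?mulr_ge0 ?prodr_ge0 ?vN //.
apply: ler_pM; rewrite ?normr_ge0 ?mulr_ge0 ?prodr_ge0 ?vN' //.
rewrite -[leRHS]mulr1; apply: ler_pM; rewrite ?prodr_ge0 ?v_le //.
by apply: prodr_ile1 => l _; rewrite normr_ge0 (le_trans (v_le _ _ _ _)).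
Qed.

End LowerBound.

(** * The loss at [u0] and local minimality *)

Lemma e_lastE (R : realType) (r : nat) (k : 'I_(r ^ 2 + 1)) :
  e_last R r 0 k = (k == ix_last r)%:R.
Proof. by rewrite mxE eqxx. Qed.

Lemma prod_e_last (R : realType) (d r : nat) (j : {ffun 'I_d -> 'I_(r ^ 2 + 1)}) :
  \prod_i e_last R r 0 (j i) = (j == [ffun=> ix_last r])%:R.
Proof.
rewrite (eq_bigr _ (fun i _ => e_lastE R (j i))) (prod_natr_bool _ xpredT).
congr (_%:R); congr nat_of_bool; apply/forallP/eqP => [j_last|-> i].
  by apply/ffunP => i; rewrite ffunE; apply/eqP/(j_last i).
by rewrite ffunE eqxx.
Qed.

Lemma f0E (R : realType) (d r m : nat) (u : cores R d m (r ^ 2 + 1)) :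
  f0 u = 2^-1 * \sum_j (T0 R d r j - tau u j) ^+ 2.
Proof.
rewrite /f0 /frobenius sqr_sqrtr ?sumr_ge0 // => [|j _]; last exact: sqr_ge0.
by congr (_ * _); apply: eq_bigr => j _; rewrite ffunE [X in _ + X]ffunE.
Qed.

Lemma f0_u0 (R : realType) (s r : nat) : f0 (u0 R s.+2 r) = 2^-1.
Proof.
rewrite /f0 T0_sub_tau_u0 /frobenius sqr_sqrtr; last first.
  by apply: sumr_ge0 => j _; exact: sqr_ge0.
rewrite (bigD1 [ffun=> ix_last r]) //= big1 => [|j /negPf j_neq].
  by rewrite ffunE prod_e_last eqxx expr1n addr0 mulr1.
by rewrite ffunE prod_e_last j_neq expr0n.
Qed.

Lemma f0_ge0 (R : realType) (d r m : nat) (u : cores R d m (r ^ 2 + 1)) : 0 <= f0 u.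
Proof. by rewrite /f0 mulr_ge0 ?invr_ge0 ?sqr_ge0. Qed.

Lemma ler_sum_sqr3 (R : realDomainType) (I : finType) (g : I -> R) (i j k : I) :
  j != i -> k != i -> k != j ->
  g i ^+ 2 + (g j ^+ 2 + g k ^+ 2) <= \sum_l g l ^+ 2.
Proof.
move=> ji ki kj; rewrite (bigD1 i) //= (bigD1 j) //= (bigD1 k) ?ki //=.
by rewrite !lerD2l lerDl sumr_ge0 // => l _; exact: sqr_ge0.
Qed.

Lemma local_min_u0 (R : realType) (s r : nat) :
  (0 < s)%N -> (0 < r)%N ->
  local_min (@f0 R s.+2 r (r ^ s.+1)) (u0 R s.+2 r).
Proof.
move=> s_gt0 r_gt0.
set D : R := #|{ffun 'I_s.+2 -> 'I_(r ^ s.+1)}|%:R.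
have D_ge0 : 0 <= D by exact: ler0n.
pose E : R := 3 ^+ s.+2.
have E_ge1 : 1 <= E by rewrite exprn_ege1 // ler1n.
(* This radius gives [eta <= 1], the smallness [D * E * eta <= 1/2] needed at both cuts and, as
   [E >= 1], the bound [D * eta <= 1/4] for the corner entry. *)
pose eta := (4 * (D * E + 1))^-1.
have den_gt0 : 0 < 4 * (D * E + 1) by nra.
have eta_gt0 : 0 < eta by rewrite invr_gt0.
have eta_eq : eta * (4 * (D * E + 1)) = 1 by rewrite mulVf // gt_eqF.
have eta01 : 0 <= eta <= 1 by apply/andP; split; nra.
have small : D * (E * eta) <= 2^-1 by nra.
have D_eta : D * eta <= 4^-1 by nra.
exists eta => // v v_lt.
have v_le i k k' j : `|v i k k' 0 j| <= eta.
  exact: le_trans (le_maxnorm _ _ _ _ _) (ltW v_lt).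
pose V i a b := `|v i a b 0 (ix_last r)|.
have m_gt0 : (0 < r ^ s.+1)%N by rewrite expn_gt0 r_gt0.
have [a1 [b1 max1]] := ex_max_entry (V ord_max) m_gt0.
have [a2 [b2 max2]] := ex_max_entry (V ord0) m_gt0.
have [j1 [j1_last j1_nlast tau1]] :=
  cut_entry_ge eta01 v_le (@injective_cut_max R s r) small max1.
have [j2 [j2_last j2_nlast tau2]] :=
  cut_entry_ge eta01 v_le (@injective_cut_0 R s r) small max2.
(* Site 1 differs from both cut sites because [s > 0]; its core supplies the small factor [eta]. *)
have mid_lt : (1 < s.+2)%N by [].
have corner : `|tau (u0 R s.+2 r + v) [ffun=> ix_last r]|
     <= D * (V ord_max a1 b1 * (V ord0 a2 b2 * eta)).
  apply: (corner_entry_le eta01 v_le (i' := ord0) (i'' := Ordinal mid_lt)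
            _ _ _ max1 max2) => //.
  by rewrite -val_eqE /= eqSS lt_eqF.
pose jn : {ffun 'I_s.+2 -> 'I_(r ^ 2 + 1)} := [ffun=> ix_last r].
have jnE l : jn l = ix_last r by rewrite ffunE.
have j1_jn : j1 != jn.
  by apply: contraNneq (j1_nlast ord0 isT) => ->; rewrite jnE.
have j2_jn : j2 != jn.
  by apply: contraNneq (j2_nlast ord_max isT) => ->; rewrite jnE.
have j2_j1 : j2 != j1.
  by apply: contraNneq (j2_nlast ord_max isT) => ->; rewrite j1_last.
rewrite f0_u0 f0E -[leLHS]mulr1 ler_pM2l ?invr_gt0 //.
(* Three distinct entries suffice: the corner and the two found by cutting. *)
apply: le_trans (ler_sum_sqr3 _ j1_jn j2_jn j2_j1).
rewrite (T0_last R (jnE ord0)) (T0_last R j1_last) (T0_last R j2_last) !prod_e_last.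
rewrite eqxx (negPf j1_jn) (negPf j2_jn) !sub0r !sqrrN.
move: corner tau1 tau2; rewrite -/(V _ a1 b1) -/(V _ a2 b2) -/jn.
have V1_ge0 : 0 <= V ord_max a1 b1 by exact: normr_ge0.
have V2_ge0 : 0 <= V ord0 a2 b2 by exact: normr_ge0.
move: (V _ a1 b1) (V _ a2 b2) V1_ge0 V2_ge0 => N1 N2 N1_ge0 N2_ge0.
set t := tau _ jn; set t1 := tau _ j1; set t2 := tau _ j2 => t_le t1_ge t2_ge.
have sq1 : N1 ^+ 2 / 4 <= t1 ^+ 2.
  rewrite -[t1 ^+ 2]real_normK ?num_real //.
  have -> : N1 ^+ 2 / 4 = (N1 / 2) ^+ 2 by field.
  by rewrite lerXn2r ?nnegrE ?divr_ge0.
have sq2 : N2 ^+ 2 / 4 <= t2 ^+ 2.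
  rewrite -[t2 ^+ 2]real_normK ?num_real //.
  have -> : N2 ^+ 2 / 4 = (N2 / 2) ^+ 2 by field.
  by rewrite lerXn2r ?nnegrE ?divr_ge0.
have t_small : t <= N1 * N2 / 4.
  apply: le_trans (ler_norm t) _; apply: le_trans t_le _.
  have -> : D * (N1 * (N2 * eta)) = N1 * N2 * (D * eta) by ring.
  by rewrite ler_wpM2l ?mulr_ge0.
(* The loss [2 * z] is at most [x * y / 2], hence at most [(x^2 + y^2) / 4], which the two squares
   compensate. *)
have arith (x y z a b : R) : x ^+ 2 / 4 <= a ^+ 2 -> y ^+ 2 / 4 <= b ^+ 2 ->
    z <= x * y / 4 -> 1 <= (1 - z) ^+ 2 + (a ^+ 2 + b ^+ 2).
  by move=> xa yb z_le; have := sqr_ge0 z; have := sqr_ge0 (x - y); nra.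
exact: arith sq1 sq2 t_small.
Qed.

(** * A global minimizer with zero loss *)

Lemma ordS_ind (n : nat) (P : 'I_n.+1 -> Prop) :
  (forall i, P i -> P (ordS i)) -> P ord0 -> forall i, P i.
Proof.
move=> PS P0 i; rewrite -(inord_val i); move: (val i) (ltn_ord i) => l.
elim: l => [|l IHl] lt_l.
  by rewrite (_ : inord 0 = ord0) //; apply: val_inj; rewrite /= inordK.
have := PS _ (IHl (ltnW lt_l)); congr P; apply: val_inj.
by rewrite /= !inordK // ?modn_small // ltnW.
Qed.

(* Bonds below r carry the first sum in T0, bond r carries the last term. *)
Definition direct_cores (R : realType) (d r m : nat) : cores R d m (r ^ 2 + 1) :=
  [ffun=> \matrix_(k, k')
     if (insub (val k), insub (val k')) is (Some a, Some b)
     then e_pair R (b : 'I_r) (a : 'I_r)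
     else if (k == r :> nat) && (k' == r :> nat) then e_last R r else 0].

(** A nonzero path has either all bonds below [r] or all bonds equal to [r]. The former are the
    image of the index set of [T0] under [h]; the latter is the single path [top]. *)
Lemma tau_direct_cores (R : realType) (d r m : nat) :
  (r < m)%N -> tau (direct_cores R d.+1 r m) = T0 R d.+1 r.
Proof.
move=> lt_rm; apply/ffunP => j; rewrite tauE T0E.
set u := direct_cores _ _ _ _.
pose F (K : {ffun 'I_d.+1 -> 'I_m}) := \prod_i u i (K i) (K (ordS i)) 0 (j i).
pose h (k : {ffun 'I_d.+1 -> 'I_r}) : {ffun 'I_d.+1 -> 'I_m} :=
  [ffun i => widen_ord (ltnW lt_rm) (k i)].
pose top : {ffun 'I_d.+1 -> 'I_m} := [ffun=> Ordinal lt_rm].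
have inj_h : injective h.
  move=> k k' /ffunP eq_h; apply/ffunP => i; apply: val_inj.
  by have := congr1 val (eq_h i); rewrite !ffunE.
have top_notin : top \notin [set h k | k in [set: {ffun 'I_d.+1 -> 'I_r}]].
  apply/imsetP => -[k _ /ffunP/(_ ord0)/(congr1 val)]; rewrite !ffunE /= => eq_r.
  by have := ltn_ord (k ord0); rewrite -eq_r ltnn.
rewrite -/(F _) (bigID (mem [set h k | k in [set: {ffun 'I_d.+1 -> 'I_r}]])) /=.
congr (_ + _).
  rewrite big_imset /=; last by move=> k k' _ _; exact: inj_h.
  apply: eq_big => [k|k _]; first by rewrite inE.
  apply: eq_bigr => i _; rewrite !ffunE mxE /= !insubT ?ltn_ord //= => lt1 lt2.
  by congr (e_pair _ _ _ _ _); apply: val_inj.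
rewrite (bigD1 top) //= [X in _ + X]big1 ?addr0 => [|K /andP[K_notin K_neq]].
  apply: eq_bigr => i _; rewrite !ffunE mxE /= insubF ?ltnn // eqxx //.
apply: contraNeq K_neq => FK_neq0.
have factor i : u i (K i) (K (ordS i)) != 0.
  apply: contraNneq FK_neq0 => u_eq0.
  by rewrite (bigD1 i) //= u_eq0 mxE mul0r.
(* A nonzero core entry joins two bonds of the same class, so the class of the bond at site 0
   spreads around the cycle. *)
have trans i : (K i < r)%N && (K (ordS i) < r)%N
             || (K i == r :> nat) && (K (ordS i) == r :> nat).
  have := factor i; rewrite ffunE mxE.
  case: insubP => [a -> _|_]; last by case: ifP; rewrite ?eqxx ?orbT.
  case: insubP => [b -> _ //|_]; by case: ifP; rewrite ?eqxx ?orbT.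
have [K0_lt|K0_ge] := ltnP (K ord0) r.
  have K_lt : forall i, (K i < r)%N.
    apply: ordS_ind => // i Ki_lt; have := trans i.
    by rewrite Ki_lt (ltn_eqF Ki_lt) orbF.
  case/negP: K_notin; apply/imsetP; exists [ffun i => Ordinal (K_lt i)]; rewrite ?inE //.
  by apply/ffunP => i; rewrite !ffunE; apply: val_inj.
apply/eqP/ffunP => i; rewrite ffunE; apply: val_inj => /=; move: i.
apply: ordS_ind => [i Ki|]; have := trans _.
  by move=> /(_ i); rewrite Ki ltnn eqxx /= => /eqP.
by move=> /(_ ord0); rewrite ltnNge K0_ge /= => /andP[/eqP].
Qed.

Theorem theorem3p3 (R : realType) (d r : nat) (hd : (3 <= d)%N) (hr : (2 <= r)%N) :
  local_min (@f0 R d r (r ^ d.-1)) (u0 R d r) /\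
  0 < @f0 R d r (r ^ d.-1) (u0 R d r) /\
  spurious_local_min (@f0 R d r (r ^ d.-1)) (u0 R d r).
Proof.
case: d hd => [|[|[|s]]] // _.
have r_gt0 : (0 < r)%N by exact: ltnW.
have loc := @local_min_u0 R s.+1 r isT r_gt0.
have f0_gt0 : 0 < f0 (u0 R s.+3 r) by rewrite f0_u0 invr_gt0.
split=> //; split=> //; split=> //.
(* The exponent is at least 2 and [r >= 2], which leaves room for the extra bond value [r]. *)
have lt_rm : (r < r ^ s.+2)%N by rewrite -{1}[r]expn1 ltn_exp2l.
have f0_direct : f0 (direct_cores R s.+3 r (r ^ s.+2)) = 0.
  rewrite /f0 tau_direct_cores // subrr /frobenius big1 ?sqrtr0 ?expr0n ?mulr0 //.
  by move=> j _; rewrite ffunE expr0n.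
exists (direct_cores R s.+3 r (r ^ s.+2)); rewrite f0_direct; split=> // v.
exact: f0_ge0.
Qed.
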